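(* Let $F\colon\mathbb{F}_2^n\to\mathbb{F}_2^n$ be an APN function. Let $U$ be an $(n-2)$-dimensional linear subspace of $\mathbb{F}_2^n$ and let $U_1=U+u_1$, $U_2=U+u_2$, $U_3=U+u_3$, $U_4=U+u_4$ be the four cosets of $U$, with $u_1=0$ and $u_2,u_3,u_4\in\mathbb{F}_2^n$, so that $\mathbb{F}_2^n=U_1\cup U_2\cup U_3\cup U_4$. Let $a_1,a_2,a_3,a_4\in\mathbb{F}_2^n$ and define $G\colon\mathbb{F}_2^n\to\mathbb{F}_2^n$ by $G(x)=F(x)+a_i$ for $x\in U_i$, $i=1,2,3,4$. Then $G$ is APN if and only if $$F(x_1)+F(x_2)+F(x_3)+F(x_4)\neq a_1+a_2+a_3+a_4$$ for every $2$-dimensional affine subspace $\{x_1,x_2,x_3,x_4\}$ of $\mathbb{F}_2^n$ satisfying $|\{x_1,x_2,x_3,x_4\}\cap U_i|=1$ for all $i=1,2,3,4$.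
   Context: A function $F\colon\mathbb{F}_2^n\to\mathbb{F}_2^n$ is APN if for every nonzero $a$ and every $b$ the set $\{x: F(x+a)+F(x)=b\}$ has at most $2$ elements. A set $\{x_1,x_2,x_3,x_4\}\subseteq\mathbb{F}_2^n$ is a $2$-dimensional affine subspace if $x_1,\dots,x_4$ are pairwise distinct and $x_1+x_2+x_3+x_4=0$. *)

(* Defs.v *)
From mathcomp Require Import all_boot all_order all_algebra.

Set Implicit Arguments.
Unset Strict Implicit.
Unset Printing Implicit Defensive.

Import GRing.Theory.
Local Open Scope ring_scope.

Definition APN (n : nat) (F : 'rV['F_2]_n -> 'rV['F_2]_n) : Prop :=
  forall a b : 'rV['F_2]_n, a != 0 ->
    (#|[set x | (F (x + a) + F x == b)%R]| <= 2)%N.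

Definition coset_of_vs (n : nat) (U : {vspace 'rV['F_2]_n})
    (u : 'rV['F_2]_n) : {set 'rV['F_2]_n} :=
  [set v + u | v in U].

(* Over F_2, four points form a 2-dimensional affine subspace iff they are
   pairwise distinct and sum to 0. *)
Definition affine_plane (n : nat) (x1 x2 x3 x4 : 'rV['F_2]_n) : Prop :=
  uniq [:: x1; x2; x3; x4] /\ x1 + x2 + x3 + x4 = 0.

(* The U + u i list each coset of U exactly once; the informal indices
   1, ..., 4 become 0, ..., 3. *)
Definition four_cosets (n : nat) (U : {vspace 'rV['F_2]_n})
    (u : 'I_4 -> 'rV['F_2]_n) : Prop :=
  injective (fun i => coset_of_vs U (u i)) /\
  \bigcup_(i < 4) coset_of_vs U (u i) = [set: 'rV['F_2]_n].

(* Main.v *)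
(* A function is APN iff its values on every 2-dimensional affine subspace have
   nonzero sum.  On an affine plane that meets some coset of U twice, the shifts
   occur in equal pairs, so G has the same sum as F; the only planes on which
   the sums differ are those meeting each coset exactly once, and there they
   differ by the sum of all the a i. *)
Require Import Defs.
From mathcomp Require Import all_boot all_order all_algebra.

Set Implicit Arguments.
Unset Strict Implicit.
Unset Printing Implicit Defensive.

Import GRing.Theory.
Local Open Scope ring_scope.

Lemma addrr_rV (n : nat) (x : 'rV['F_2]_n) : x + x = 0.
Proof. by apply/rowP => j; rewrite !mxE addrr_pchar2 ?pchar_Fp. Qed.

Lemma addr_eq0_rV (n : nat) (x y : 'rV['F_2]_n) : (x + y == 0) = (x == y).
Proof.
by rewrite -[RHS]subr_eq0; congr (_ + _ == 0); apply/eqP; rewrite -addr_eq0 addrr_rV.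
Qed.

(** A plane on which [F] sums to zero yields three solutions [x1], [x2], [x3] of one derivative
    equation, in direction [x1 + x2]. Conversely, solutions in direction [a] come in pairs [x],
    [x + a], so a third solution brings a second pair, and the two pairs form such a plane. *)
Lemma APN_affine_planeP (n : nat) (F : 'rV['F_2]_n -> 'rV['F_2]_n) :
  APN F <-> forall x1 x2 x3 x4, affine_plane x1 x2 x3 x4 ->
              F x1 + F x2 + F x3 + F x4 <> 0.
Proof.
split=> [apnF x1 x2 x3 x4 [Ux x0] F0 | nF a b a0].
  have n12 : x1 != x2 by move: Ux; rewrite /= !inE !negb_or; case/andP=> /and3P[].
  have x3a : x3 + (x1 + x2) = x4.
    by apply/eqP; rewrite -addr_eq0_rV [x3 + _]addrC x0.
  have x1a : x1 + (x1 + x2) = x2 by rewrite addrA addrr_rV add0r.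
  have x2a : x2 + (x1 + x2) = x1 by rewrite addrC -addrA addrr_rV addr0.
  have := apnF (x1 + x2) (F x1 + F x2); rewrite addr_eq0_rV => /(_ n12).
  apply/negP; rewrite -ltnNge; apply/card_gt2P; exists x1, x2, x3.
  split; rewrite ?inE ?x1a ?x2a ?x3a //.
  - split; [by rewrite addrC | by [] |].
    by rewrite -addr_eq0_rV [F x4 + _]addrC [_ + (F x1 + F x2)]addrC addrA F0.
  - move: Ux; rewrite /= !inE !negb_or [x3 == x1]eq_sym.
    by case/andP=> /and3P[-> -> _] /andP[/andP[-> _] _].
rewrite leqNgt; apply/negP => /card_gt2P[x [y [z [[]]]]].
rewrite !inE => /eqP Fx /eqP Fy /eqP Fz [nxy nyz nzx].
have wit w : F (w + a) + F w = b -> w != x -> w != x + a -> False.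
  move=> Fw nwx nwxa.
  have na v : v != v + a by rewrite -addr_eq0_rV addrA addrr_rV add0r.
  have nxwa : x != w + a.
    by apply: contra nwxa => /eqP ->; rewrite -addrA addrr_rV addr0.
  apply: (nF x (x + a) w (w + a)).
    split; last by rewrite (addrA x) addrr_rV add0r (addrC w) addrr_rV.
    rewrite /= !inE !negb_or (inj_eq (addIr a)) -!(eq_sym w).
    by rewrite !na nwx nwxa nxwa.
  by rewrite [F x + _]addrC Fx -addrA [F w + _]addrC Fw addrr_rV.
(* At most one of [y], [z] can be the partner [x + a] of [x]; the other one serves as [w]. *)
have [yxa | nyxa] := eqVneq y (x + a).
  by apply: (wit z) => //; rewrite -yxa eq_sym.
by apply: (wit y) => //; rewrite eq_sym.
Qed.

Section Cosets.

Variables (n : nat) (U : {vspace 'rV['F_2]_n}) (u : 'I_4 -> 'rV['F_2]_n).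
Hypothesis hu : four_cosets U u.
Implicit Types (x : 'rV['F_2]_n) (i : 'I_4).

Lemma mem_coset_of_vs (v x : 'rV['F_2]_n) :
  (x \in coset_of_vs U v) = (x - v \in U).
Proof.
apply/imsetP/idP => [[w wU ->] | xvU]; first by rewrite addrK.
by exists (x - v); rewrite ?subrK.
Qed.

Lemma coset_index_exists x : exists i, x \in coset_of_vs U (u i).
Proof.
have : x \in \bigcup_(i < 4) coset_of_vs U (u i) by rewrite hu.2 inE.
by case/bigcupP => i _; exists i.
Qed.

Definition coset_index x : 'I_4 := xchoose (coset_index_exists x).

(** Two cosets sharing [x] coincide as sets, and the injectivity in [four_cosets] then identifies
    their indices. *)
Lemma coset_indexE x i : (x \in coset_of_vs U (u i)) = (coset_index x == i).
Proof.
have xU := xchooseP (coset_index_exists x).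
rewrite -/(coset_index x) in xU.
apply/idP/eqP => [xi | <- //]; apply: hu.1; apply/setP => y.
move: xi xU; rewrite !mem_coset_of_vs => xi xU.
have dU : u i - u (coset_index x) \in U.
  by rewrite -[u i](subKr x) addrAC rpredB.
by rewrite -[RHS](rpredDr _ dU) subrKA.
Qed.

Lemma coset_index_eq x y : (coset_index x == coset_index y) = (x - y \in U).
Proof.
rewrite -coset_indexE mem_coset_of_vs.
have yU : y - u (coset_index y) \in U by rewrite -mem_coset_of_vs coset_indexE.
by rewrite -(rpredDr (x - y) yU) subrKA.
Qed.

(** In characteristic 2 the hypothesis says [x1 - x2 = x3 - x4], and two points share a coset
    exactly when their difference lies in [U]. *)
Lemma coset_index_plane x1 x2 x3 x4 : x1 + x2 + x3 + x4 = 0 ->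
  (coset_index x1 == coset_index x2) = (coset_index x3 == coset_index x4).
Proof.
move=> x0; rewrite !coset_index_eq; congr (_ \in U).
have oppE (v : 'rV['F_2]_n) : - v = v by apply/eqP; rewrite -addr_eq0_rV addNr.
by apply/eqP; rewrite -addr_eq0_rV !oppE addrA x0.
Qed.

(** Since [s] has no repetition, each cardinal counts the occurrences of [i] among the indices of
    [s]. The permutation form lets the sum of all [a i] be reindexed by the points of a plane. *)
Lemma transversal_perm_eq (s : seq 'rV['F_2]_n) : uniq s ->
  (forall i, #|[set x in s] :&: coset_of_vs U (u i)| = 1%N) <->
  perm_eq (map coset_index s) (enum 'I_4).
Proof.
move=> Us.
have cardE i : #|[set x in s] :&: coset_of_vs U (u i)|
               = count_mem i (map coset_index s).
  rewrite count_map -size_filter -(card_uniqP (filter_uniq _ Us)).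
  by apply: eq_card => x; rewrite !inE mem_filter coset_indexE andbC.
have enumE i : count_mem i (enum 'I_4) = 1%N.
  by rewrite count_uniq_mem ?enum_uniq // mem_enum.
split=> [c1 | /permP cE i].
  by apply/allP => i _; rewrite /= enumE -cardE c1.
by rewrite cardE cE enumE.
Qed.

End Cosets.

Theorem theorem5 (n : nat) (F : 'rV['F_2]_n -> 'rV['F_2]_n)
    (hF : APN F)
    (U : {vspace 'rV['F_2]_n}) (hU : (\dim U + 2)%N = n)
    (u : 'I_4 -> 'rV['F_2]_n) (hu0 : u ord0 = 0) (hu : four_cosets U u)
    (a : 'I_4 -> 'rV['F_2]_n)
    (G : 'rV['F_2]_n -> 'rV['F_2]_n)
    (hG : forall (i : 'I_4) (x : 'rV['F_2]_n),
        x \in coset_of_vs U (u i) -> G x = F x + a i) :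
  APN G <->
  (forall x1 x2 x3 x4 : 'rV['F_2]_n,
     affine_plane x1 x2 x3 x4 ->
     (forall i : 'I_4,
        #|[set x1; x2; x3; x4] :&: coset_of_vs U (u i)| = 1%N) ->
     F x1 + F x2 + F x3 + F x4 <> \sum_(i < 4) a i).
Proof.
pose c := coset_index hu.
have GE x : G x = F x + a (c x) by apply: hG; rewrite (coset_indexE hu).
have sumG x1 x2 x3 x4 : G x1 + G x2 + G x3 + G x4 =
    (F x1 + F x2 + F x3 + F x4) + (a (c x1) + a (c x2) + a (c x3) + a (c x4)).
  by rewrite !GE (addrACA (F x1)) (addrACA (F x1 + F x2)) [LHS]addrACA.
have setE (x1 x2 x3 x4 : 'rV['F_2]_n) :
    [set x1; x2; x3; x4] = [set x in [:: x1; x2; x3; x4]].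
  by apply/setP => x; rewrite !inE -!orbA.
have sumE x1 x2 x3 x4 : perm_eq (map c [:: x1; x2; x3; x4]) (enum 'I_4) ->
    \sum_(i < 4) a i = a (c x1) + a (c x2) + a (c x3) + a (c x4).
  by move=> pc; rewrite -big_enum -(perm_big _ pc) /= !big_cons big_nil addr0 !addrA.
split=> [/APN_affine_planeP apnG x1 x2 x3 x4 px | nF].
  rewrite setE => /(transversal_perm_eq hu px.1) /sumE aE Fa.
  by apply: (apnG _ _ _ _ px); rewrite sumG -aE Fa addrr_rV.
apply/APN_affine_planeP => x1 x2 x3 x4 px; rewrite sumG => /eqP.
rewrite addr_eq0_rV => /eqP Fa.
have [Uc | nUc] := boolP (uniq (map c [:: x1; x2; x3; x4])).
  (* Four distinct indices exhaust ['I_4], so this plane meets each coset once and [nF] applies. *)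
  have pc : perm_eq (map c [:: x1; x2; x3; x4]) (enum 'I_4).
    have sub : {subset map c [:: x1; x2; x3; x4] <= enum 'I_4}.
      by move=> i _; rewrite mem_enum.
    apply: uniq_perm (enum_uniq _) _ => //.
    by have [] := uniq_min_size Uc sub; rewrite ?size_enum_ord.
  apply: (nF _ _ _ _ px); last by rewrite Fa (sumE _ _ _ _ pc).
  by rewrite setE; apply/(transversal_perm_eq hu px.1).
(* With a repeated index, it remains to show that the four shifts sum to zero, which contradicts
   [hF]. *)
apply: ((APN_affine_planeP F).1 hF _ _ _ _ px); rewrite Fa.
(* Two points in one coset force the other two into one coset as well, so the
   shifts cancel in pairs. *)
have cP y1 y2 y3 y4 : y1 + y2 + y3 + y4 = 0 -> (c y1 == c y2) = (c y3 == c y4).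
  exact: coset_index_plane.
have x0 := px.2.
have y0 : x1 + x3 + x2 + x4 = 0 by rewrite -x0 [x1 + x3 + x2]addrAC.
have z0 : x1 + x4 + x2 + x3 = 0 by rewrite -x0 [RHS]addrAC [x1 + x2 + x4]addrAC.
have e12 := cP _ _ _ _ x0; have e13 := cP _ _ _ _ y0; have e14 := cP _ _ _ _ z0.
(* The six comparisons of indices collapse to three, one for each splitting of the plane into two
   pairs. *)
move: nUc; rewrite /= !inE e12 e13 e14.
rewrite !negb_and !negbK -!orbA !orbF.
have [c34 _|_] := eqVneq (c x3) (c x4).
  move: e12; rewrite c34 eqxx => /eqP ->.
  by rewrite addrr_rV add0r addrr_rV.
have [c24 _|_] := eqVneq (c x2) (c x4).
  move: e13; rewrite c24 eqxx => /eqP ->.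
  by rewrite -addrA addrr_rV.
rewrite /= orbF orbb => /eqP c23.
move: e14; rewrite c23 eqxx => /eqP ->.
by rewrite -(addrA (a (c x4))) addrr_rV addr0 addrr_rV.
Qed.
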